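(* Let $k\in\mathbb{N}$. The map $$J\mapsto P=\{(p,\,h_J(p)-h_J(0)) \mid 0\le p\le 2k+1\}$$ is a bijection between the set of balanced order ideals $J$ of $Q$ and the set of lattice paths (viewed as their sets of lattice points) from $(0,0)$ to $(2k+1,d)$, where $d$ ranges over the positive integers.
   Context: Let $Q=\{(a,b)\in\mathbb{Z}^2\mid 1\le a-b\le 2k+2\}$, partially ordered as the reflexive-transitive closure of $(a,b)\ge(a+1,b)$ and $(a,b)\ge(a,b+1)$. An order ideal of $Q$ is a subset $J$ with $y\in J$, $x\le y\Rightarrow x\in J$; it is proper if $J\ne Q$. For a proper non-empty order ideal $J$ and $0\le p\le 2k+1$, the height $h_J(p)$ is the maximum of $2k+1-a-b$ over $(a,b)\in J$ with $a-b=2k+2-p$. Such $J$ is balanced if $h_J(0)<0$, $h_J(2k+1)\ge 0$, and $|h_J(0)+h_J(2k+1)|=1$. A lattice path from $(0,0)$ to $(n,d)$ is a path in $\mathbb{Z}^2$ using steps $(1,1)$ and $(1,-1)$. *)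

(* Defs.v *)
From Stdlib Require Export Relation_Operators.
From mathcomp Require Export all_boot all_order all_algebra.
From mathcomp Require Export all_classical.
Set Implicit Arguments.
Unset Strict Implicit.
Unset Printing Implicit Defensive.
Import Order.TTheory GRing.Theory Num.Theory.
Local Open Scope classical_set_scope.
Local Open Scope ring_scope.

Definition Q (k : nat) : set (int * int) :=
  [set x : int * int | 1 <= x.1 - x.2 <= (2 * k + 2)%:Z].

(* [Qstep k x y] : the generating relation x >= y of the order on Q. *)
Definition Qstep (k : nat) (x y : int * int) : Prop :=
  [/\ Q k x, Q k y & y = (x.1 + 1, x.2) \/ y = (x.1, x.2 + 1)].

(* The closure is taken on int * int, so it also relates each point outside Q
   to itself; it is only used between points of Q. *)
Definition Qle (k : nat) (x y : int * int) : Prop :=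
  clos_refl_trans (int * int) (Qstep k) y x.

Definition order_ideal (k : nat) (J : set (int * int)) : Prop :=
  J `<=` Q k /\ forall x y, Q k x -> J y -> Qle k x y -> J x.

(* The greatest element of A; the value 0 is a dummy used when there is none. *)
Definition maximum (A : set int) : int := xget 0 (A `&` ubound A).

(* When J is a proper non-empty order ideal of Q and p <= 2k+1, the set below
   is non-empty and bounded above, so its maximum is not the dummy value. *)
Definition height (k : nat) (J : set (int * int)) (p : nat) : int :=
  maximum [set (2 * k + 1)%:Z - x.1 - x.2 |
    x in [set x : int * int | J x /\ x.1 - x.2 = (2 * k + 2)%:Z - p%:Z]].

Definition balanced (k : nat) (J : set (int * int)) : Prop :=
  [/\ order_ideal k J, J <> Q k & J !=set0] /\
  [/\ height k J 0 < 0, 0 <= height k J (2 * k + 1)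
    & `|height k J 0 + height k J (2 * k + 1)| = 1 :> int].

Definition lattice_step (x y : int * int) : bool :=
  (y == (x.1 + 1, x.2 + 1)) || (y == (x.1 + 1, x.2 - 1)).

(* [x :: s] is the sequence of points of a lattice path from x to y. *)
Definition lattice_path (x y : int * int) (s : seq (int * int)) : bool :=
  path lattice_step x s && (last x s == y).

Definition lattice_path_sets (x y : int * int) : set (set (int * int)) :=
  [set [set` x :: s] | s in [set s | lattice_path x y s]].

Definition height_path (k : nat) (J : set (int * int)) : set (int * int) :=
  [set (p%:Z, height k J p - height k J 0)
    | p in [set p : nat | (p <= 2 * k + 1)%N]].

(* Main.v *)
Require Import Defs.
From mathcomp Require Import zify.
Set Implicit Arguments.
Unset Strict Implicit.
Unset Printing Implicit Defensive.
Import Order.TTheory GRing.Theory Num.Theory.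
Local Open Scope classical_set_scope.
Local Open Scope ring_scope.

(* On the diagonal a - b = 2k+2-p the value 2k+1-a-b equals p-1-2b.  Hence
   the height function h of a proper non-empty ideal satisfies
   h p = p - 1 (mod 2), and closure of the ideal under the two generating
   relations says |h (p+1) - h p| = 1; conversely an ideal is the region
   below the graph of its height function.  For a balanced ideal, h 0 is odd
   and d = h (2k+1) - h 0 is - 2 h 0 + 1 or - 2 h 0 - 1, so h 0 can be
   recovered from d as - (2 (d %/ 4) + 1). *)

(** * Maxima of integer sets, the order on [Q], height profiles *)

Lemma maximum_eq (A : set int) (v : int) :
  A v -> ubound A v -> maximum A = v.
Proof.
move=> Av uv; rewrite /maximum; apply: xget_unique; first by split.
move=> w [Aw uw]; apply/eqP; rewrite eq_le.
by apply/andP; split; [exact: uv | exact: uw].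
Qed.

(** An element of [A] that is not an upper bound can be traded for a larger one; the gap to [u]
    limits the number of trades. *)
Lemma maximumP (A : set int) (v u : int) :
  A v -> ubound A u -> A (maximum A) /\ ubound A (maximum A).
Proof.
move=> Av uA.
suff [m [Am um]] : exists m, A m /\ ubound A m by rewrite (maximum_eq Am um).
have [n] : exists n : nat, u - v <= n%:Z by exists `|(u - v)%R|%N; lia.
elim: n v Av => [|n IH] v Av le_uv.
  by exists v; split=> // w /uA; lia.
have [uv|/existsNP[w /not_implyP[Aw ltvw]]] := pselect (ubound A v).
  by exists v.
by apply: (IH w Aw); move: ltvw; lia.
Qed.

(* The strip is wide enough for a monotone staircase inside Q to join any two
   componentwise comparable points. *)
Lemma Qle_componentwise (k : nat) (x y : int * int) :
  Q k x -> Q k y -> y.1 <= x.1 -> y.2 <= x.2 -> Qle k x y.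
Proof.
case: x y => [a b] [a' b']; rewrite /Qle /Q /=.
have [n] : exists n : nat, (a - a') + (b - b') <= n%:Z.
  by exists `|((a - a') + (b - b'))%R|%N; lia.
elim: n a' b' => [|n IH] a' b' le_n Qx Qy lea leb.
  have -> : a' = a by lia.
  have -> : b' = b by lia.
  exact: rt_refl.
have [[? ?]|neq] : (a' = a /\ b' = b) \/ (a' < a \/ b' < b) by lia.
  by subst; exact: rt_refl.
(* On the edge [a' - b' = 2k+2] the bound on [a - b] forces [b' < b]; on the edge [a' - b' = 1] it
   forces [a' < a]. So some step towards [(a, b)] stays in [Q]. *)
have [go|go] : (a' < a /\ a' - b' < (2 * k + 2)%:Z)
    \/ (b' < b /\ 1 < a' - b') by lia.
- apply: (rt_trans _ _ _ (a' + 1, b')); last by apply: IH; lia.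
  by apply: rt_step; split; rewrite /Q /=; [lia|lia|left].
- apply: (rt_trans _ _ _ (a', b' + 1)); last by apply: IH; lia.
  by apply: rt_step; split; rewrite /Q /=; [lia|lia|right].
Qed.

(** The witness [b] encodes the parity condition and is the second coordinate of the point of
    diagonal [p] with value [h p]. *)
Definition height_profile (k : nat) (h : nat -> int) : Prop :=
  (forall p, (p <= 2 * k + 1)%N -> exists b : int, h p = p%:Z - 1 - 2 * b) /\
  (forall p, (p < 2 * k + 1)%N -> `|h p.+1 - h p| = 1 :> int).

Definition ideal_below (k : nat) (h : nat -> int) : set (int * int) :=
  [set x | exists2 p : nat, (p <= 2 * k + 1)%N &
    x.1 - x.2 = (2 * k + 2)%:Z - p%:Z /\ (2 * k + 1)%:Z - x.1 - x.2 <= h p].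

Lemma eq_ideal_below (k : nat) (h h' : nat -> int) :
  (forall p, (p <= 2 * k + 1)%N -> h p = h' p) ->
  ideal_below k h = ideal_below k h'.
Proof.
by move=> eqh; apply/seteqP; split=> x [p lep [px hx]]; exists p => //;
  split=> //; rewrite ?eqh // -eqh.
Qed.

(** * From an ideal to its height function *)

Section Ideal.
Variables (k : nat) (J : set (int * int)).
Hypotheses (Jideal : order_ideal k J) (Jproper : J <> Q k) (Jn0 : J !=set0).

Lemma ideal_down (x y : int * int) :
  Q k x -> J y -> y.1 <= x.1 -> y.2 <= x.2 -> J x.
Proof.
have [JQ Jd] := Jideal.
by move=> Qx Jy le1 le2; apply: (Jd x y) => //;
  apply: Qle_componentwise => //; exact: JQ.
Qed.

Lemma heightP (p : nat) : (p <= 2 * k + 1)%N ->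
  (exists2 b : int, height k J p = p%:Z - 1 - 2 * b &
     J (b + (2 * k + 2)%:Z - p%:Z, b)) /\
  (forall x, J x -> x.1 - x.2 = (2 * k + 2)%:Z - p%:Z ->
     (2 * k + 1)%:Z - x.1 - x.2 <= height k J p).
Proof.
move=> lep; have [[ya yb] Jy] := Jn0.
have [[za zb] Qz nJz] : exists2 z, Q k z & ~ J z.
  apply: contrapT => nz; apply: Jproper; apply/seteqP; split.
    exact: Jideal.1.
  by move=> z Qz; apply: contrapT => nJz; apply: nz; exists z.
set A := [set (2 * k + 1)%:Z - x.1 - x.2 |
    x in [set x : int * int | J x /\ x.1 - x.2 = (2 * k + 2)%:Z - p%:Z]].
(* Large enough for the point of diagonal [p] with second coordinate [b0] to dominate [y] in both
   coordinates. *)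
pose b0 := `|ya|%:Z + `|yb|%:Z + (2 * k + 2)%:Z.
have Av : A ((2 * k + 1)%:Z - (b0 + (2 * k + 2)%:Z - p%:Z) - b0).
  exists (b0 + (2 * k + 2)%:Z - p%:Z, b0) => //; split => /=; last by lia.
  by apply: (ideal_down _ Jy); rewrite /Q /b0 /=; lia.
(* A point of [J] exceeds the missing point [z] in some coordinate, for otherwise [z] would lie in
   [J]; as [a - b] is fixed, [a + b] is bounded below. *)
have uA : ubound A (2 * `|za|%:Z + 2 * `|zb|%:Z + 6 * (2 * k + 2)%:Z).
  move=> _ [[a b] [Jx /= px] <-].
  have [le1|lt1] := lerP a za; last by lia.
  have [le2|lt2] := lerP b zb; last by lia.
  by case: nJz; apply: (ideal_down _ Jx).
have [] := maximumP Av uA; rewrite -/(height k J p).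
move=> [[a b] [Jx /= px] eqh] um; split.
  exists b; first by rewrite -eqh; lia.
  by have <- : a = b + (2 * k + 2)%:Z - p%:Z by lia.
by move=> x Jx' px'; apply: um; exists x.
Qed.

Lemma height_profile_height : height_profile k (height k J).
Proof.
split=> p lep.
  by have [[b eqb _] _] := heightP lep; exists b.
have [[b eqb Jb] ub] := heightP (ltnW lep).
have [[c eqc Jc] uc] := heightP lep.
(* One step from the top point of either diagonal reaches the other with value 1 less. So the
   heights differ by at most 1, and parity rules out equality. *)
have := uc (b + (2 * k + 2)%:Z - p%:Z, b + 1).
have := ub (c + (2 * k + 2)%:Z - p.+1%:Z + 1, c).
move=> /= h1 h2.
have {}h1 := h1 (ideal_down (x := (_, _)) _ Jc _ _).
have {}h2 := h2 (ideal_down (x := (_, _)) _ Jb _ _).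
rewrite /Q /= in h1 h2.
have {}h1 := h1 ltac:(lia) ltac:(lia) ltac:(lia) ltac:(lia).
have {}h2 := h2 ltac:(lia) ltac:(lia) ltac:(lia) ltac:(lia).
lia.
Qed.

Lemma ideal_below_height : ideal_below k (height k J) = J.
Proof.
apply/seteqP; split=> [[a b] [p lep [/= px hx]]|[a b] Jx].
  have [[c eqc Jc] _] := heightP lep.
  by apply: (ideal_down _ Jc); rewrite /Q /=; lia.
have /= Qx := Jideal.1 _ Jx; rewrite /Q /= in Qx.
have [p eqp] : exists p : nat, p%:Z = (2 * k + 2)%:Z - (a - b).
  by exists `|((2 * k + 2)%:Z - (a - b))%R|%N; lia.
have lep : (p <= 2 * k + 1)%N by lia.
exists p => //; split => /=; first by lia.
by apply: (heightP lep).2 (a, b) Jx _ => /=; lia.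
Qed.

End Ideal.

(** * From a height profile to an ideal *)

Section IdealBelow.
Variables (k : nat) (h : nat -> int).
Hypothesis hP : height_profile k h.

(** A generating step moves to a neighbouring diagonal and lowers the value by 1, while [h] drops by
    at most 1 there. *)
Lemma order_ideal_below : order_ideal k (ideal_below k h).
Proof.
split=> [[a b] [p lep [/= px _]]|x y _]; first by rewrite /Q /=; lia.
move=> + leyx; elim: leyx => {x y} [|//|x y z _ IH1 _ IH2 /IH1/IH2//].
move=> [a b] y [_ Qy eqy] [p lep [/= px hx]].
rewrite /= in eqy; case: eqy => eqy; subst y; rewrite /Q /= in Qy.
- case: p => [|p] in lep px hx *; first by lia.
  exists p; first by lia.
  by have := hP.2 p lep; split=> /=; lia.
- exists p.+1; first by lia.
  by have := hP.2 p ltac:(lia); split=> /=; lia.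
Qed.

Lemma height_ideal_below (p : nat) :
  (p <= 2 * k + 1)%N -> height k (ideal_below k h) p = h p.
Proof.
move=> lep; have [b eqb] := hP.1 _ lep; apply: maximum_eq.
  exists (b + (2 * k + 2)%:Z - p%:Z, b) => /=; last by lia.
  by split; last lia; exists p => //=; lia.
move=> _ [[a c] [[q leq [/= qx hx]] px] <-] /=.
by have <- : q = p by lia.
Qed.

Lemma ideal_below_neq : ideal_below k h <> Q k.
Proof.
move=> eqJ; have [b eqb] := hP.1 0%N isT.
(* This point of diagonal 0 has value [h 0 + 2], just above the region. *)
have : Q k (b - 1 + (2 * k + 2)%:Z, b - 1) by rewrite /Q /=; lia.
rewrite -eqJ => -[p lep [/= px hx]].
have p0 : p = 0%N by lia.
by subst p; lia.
Qed.

Lemma ideal_below_nonempty : ideal_below k h !=set0.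
Proof.
have [b eqb] := hP.1 0%N isT.
by exists (b + (2 * k + 2)%:Z, b); exists 0%N => //=; lia.
Qed.

End IdealBelow.

(** * Lattice paths as graphs of functions *)

Definition graph (n : nat) (g : nat -> int) : set (int * int) :=
  [set (p%:Z, g p) | p in [set p : nat | (p <= n)%N]].

Lemma graph_inj (n : nat) (g g' : nat -> int) :
  graph n g = graph n g' -> forall p, (p <= n)%N -> g p = g' p.
Proof.
move=> eqg p lep.
have : graph n g (p%:Z, g p) by exists p.
by rewrite eqg => -[q _ [qp <-]]; congr g'; lia.
Qed.

Lemma path_lattice_step (x : int * int) (s : seq (int * int)) :
  path lattice_step x s ->
  forall p, (p <= size s)%N -> (nth x (x :: s) p).1 = x.1 + p%:Z.
Proof.
move=> /(pathP x) xs; elim=> [|p IH] lep /=; first by rewrite addr0.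
have := xs p lep; have {IH} := IH (ltnW lep).
case: (nth x (x :: s) p) => a b /= -> /=.
by move=> /orP[] /eqP -> /=; lia.
Qed.

(** Each step raises the abscissa by 1, so the point number [p] of a path has abscissa [p], and
    listing a graph by abscissa gives the path back. *)
Lemma lattice_path_setsP (n : nat) (d : int) (P : set (int * int)) :
  lattice_path_sets (0, 0) (n%:Z, d) P <->
  exists g : nat -> int, [/\ g 0%N = 0, g n = d,
    forall p, (p < n)%N -> `|g p.+1 - g p| = 1 :> int & P = graph n g].
Proof.
split=> [[s /= /andP[pth /eqP lst] <-]|[g [g0 gn gs ->]]].
  pose x : int * int := (0, 0); pose pt := nth x (x :: s).
  have abscissa := path_lattice_step pth; rewrite -/x -/pt /= in abscissa.
  have szn : size s = n.
    have := abscissa (size s) (leqnn _).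
    by rewrite /pt nth_last /= lst /=; lia.
  exists (fun p => (pt p).2); split=> //.
  - by rewrite -szn /pt nth_last /= lst.
  - move=> p ltp; rewrite -szn in ltp; have /(pathP x) pth' := pth.
    have := pth' p ltp; rewrite -/x -/(pt p) /lattice_step.
    have -> : nth x s p = pt p.+1 by [].
    by case/orP => /eqP -> /=; lia.
  apply/seteqP; split=> [y /= ys|_ [p /= lep <-]].
    have ltp : (index y (x :: s) < size (x :: s))%N by rewrite index_mem.
    exists (index y (x :: s)); first by rewrite /= -szn.
    have /= := abscissa (index y (x :: s)) ltp; rewrite add0r => <-.
    by rewrite -surjective_pairing /pt nth_index.
  have := abscissa p; rewrite szn add0r => /(_ lep) <-.
  by rewrite -surjective_pairing /pt mem_nth //= szn.
pose pt p := (p%:Z, g p); have pt0 : (0, 0) = pt 0%N by rewrite /pt g0.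
exists [seq pt p | p <- iota 1 n]; last first.
  apply/seteqP; rewrite pt0 -map_cons.
  rewrite -[0%N :: iota 1 n]/(iota 0 n.+1).
  split=> [y /mapP[p]|_ [p lep <-]].
    by rewrite mem_iota => lep ->; exists p.
  by apply/mapP; exists p => //; rewrite mem_iota.
rewrite /= /lattice_path pt0; apply/andP; split.
  apply/(pathP (pt 0%N)) => p; rewrite size_map size_iota => ltp.
  rewrite -map_cons -[0%N :: iota 1 n]/(iota 0 n.+1).
  rewrite !(nth_map 0%N) ?size_iota ?nth_iota ?(leqW ltp) //.
  rewrite /lattice_step /pt /= !xpair_eqE; have := gs p ltp.
  by rewrite add0n add1n; lia.
rewrite last_map (last_nth 0%N) size_iota -[0%N :: iota 1 n]/(iota 0 n.+1).
by rewrite nth_iota // add0n /pt gn.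
Qed.

(** * The bijection *)

Lemma height_path_graph (k : nat) (J : set (int * int)) :
  height_path k J = graph (2 * k + 1) (fun p => height k J p - height k J 0).
Proof. by []. Qed.

(** Write the odd negative [height k J 0] as [-(2m+1)]. The last height is even, hence [2m] or
    [2m+2], and the difference is [4m+1] or [4m+3], with quotient [m] by 4. *)
Lemma balanced_height0 (k : nat) (J : set (int * int)) : balanced k J ->
  height k J 0
    = - (2 * ((height k J (2 * k + 1) - height k J 0) %/ 4)%Z + 1).
Proof.
move=> [[Ji Jp Jn] [h0 hn hs]].
have [+ _] := height_profile_height Ji Jp Jn => par.
have [b eqb] := par 0%N isT; have [c eqc] := par (2 * k + 1)%N (leqnn _).
move: h0 hn hs; rewrite eqb eqc; lia.
Qed.

Theorem theorem3p14 (k : nat) :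
  set_bij
    [set J : set (int * int) | balanced k J]
    [set P : set (int * int) |
      exists2 d : int, 0 < d & lattice_path_sets (0, 0) ((2 * k + 1)%:Z, d) P]
    (height_path k).
Proof.
split.
- move=> J [[Ji Jp Jn] [h0 hn hs]].
  exists (height k J (2 * k + 1) - height k J 0); first by lia.
  apply/lattice_path_setsP.
  exists (fun p => height k J p - height k J 0); split=> //.
    by rewrite subrr.
  move=> p ltp; have [_ /(_ p ltp)] := height_profile_height Ji Jp Jn.
  lia.
- move=> J J' /set_mem bJ /set_mem bJ'; rewrite !height_path_graph.
  move=> /graph_inj eqg.
  have eq0 : height k J 0 = height k J' 0.
    by rewrite (balanced_height0 bJ) (balanced_height0 bJ') eqg.
  have [[Ji Jp Jn] _] := bJ; have [[Ji' Jp' Jn'] _] := bJ'.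
  rewrite -(ideal_below_height Ji Jp Jn) -(ideal_below_height Ji' Jp' Jn').
  by apply: eq_ideal_below => p /eqg; lia.
- move=> P [d d0 /lattice_path_setsP[g [g0 gn gs ->]]].
  pose h0 : int := - (2 * (d %/ 4)%Z + 1).
  pose h p := g p + h0.
  have hP : height_profile k h.
    split=> p lep; last by have := gs p lep; rewrite /h; lia.
    elim: p lep => [|p IH] lep.
      by exists (d %/ 4)%Z; rewrite /h g0 /h0; lia.
    have [b eqb] := IH (ltnW lep); have := gs p lep; rewrite /h in eqb *.
    (* An up step keeps the witness [b], a down step raises it by 1. *)
    have [up|dn] := lerP (g p) (g p.+1) => ?.
      by exists b; lia.
    by exists (b + 1); lia.
  have hE := height_ideal_below hP.
  exists (ideal_below k h).
    split; first by split; [exact: order_ideal_below | exact: ideal_below_neq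
      | exact: ideal_below_nonempty].
    (* Parity at the endpoint makes [d] odd, so with [m = d %/ 4] the last height is [2m] or [2m+2],
       which is balance. *)
    have [c eqc] := hP.1 (2 * k + 1)%N (leqnn _).
    rewrite !hE //; move: eqc; rewrite /h g0 gn /h0; split; lia.
  rewrite height_path_graph; apply/seteqP.
  by split=> _ [p /= lep <-]; exists p => //; rewrite !hE // /h g0; congr pair;
    lia.
Qed.
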